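(* Let $S$ be a numerical set with $S\neq\mathbb{N}$, and let $\widetilde{S}$ be its complement. Then $$\widetilde{S}=\{B(S)-s \mid s\in S,\ s\leq B(S)\}\cup\{n\in\mathbb{N}\mid n\geq B(S)\}.$$
   Context: $\mathbb{N}=\{0,1,2,\dots\}$. A numerical set is a subset $S\subseteq\mathbb{N}$ with $0\in S$ and $\mathbb{N}\setminus S$ finite. The elements of $\mathbb{N}\setminus S$ are the gaps of $S$. $F(S)$ is the largest gap (the Frobenius number). For $S\neq\mathbb{N}$, the base is $B(S)=\max\{s\in S\mid s<F(S)\}$. Young diagram of a numerical set $S$: it has one left-justified row of boxes for each gap $\ell$ of $S$. The top row corresponds to $F(S)$, and the gaps decrease going down. The row for the gap $\ell$ has length $|\{s\in S\mid s<\ell\}|$, so row lengths weakly decrease from top to bottom. This gives a bijection between numerical sets and Young diagrams, with $\mathbb{N}$ corresponding to the empty diagram. Complement of a Young diagram with row lengths $\lambda_1\ge\lambda_2\ge\dots\ge\lambda_g$ (top to bottom): it is the Young diagram with row lengths $\lambda_1-\lambda_g\ge\lambda_1-\lambda_{g-1}\ge\dots\ge\lambda_1-\lambda_1$, rows of length $0$ being discarded. Geometrically, complete the diagram to the $g\times\lambda_1$ rectangle, take the boxes not in the diagram, and rotate them by $180^\circ$. The complement $\widetilde{S}$ of a numerical set $S$ is the numerical set whose Young diagram is the complement of the Young diagram of $S$. In particular $\widetilde{\mathbb{N}}=\mathbb{N}$. *)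

(* Defs.v *)
From mathcomp Require Import all_boot finmap.
From mathcomp Require Import boolp classical_sets cardinality.

Set Implicit Arguments.
Unset Strict Implicit.
Unset Printing Implicit Defensive.

Local Open Scope nat_scope.
Local Open Scope classical_set_scope.

Definition numerical_set (S : set nat) : Prop := S 0 /\ finite_set (~` S).

(* In decreasing order. [fset_set] is the empty set on an infinite argument, so
   this is meaningful only when [~` S] is finite. *)
Definition gaps (S : set nat) : seq nat := sort geq (fset_set (~` S)).

(* By convention 0 when S has no gap. *)
Definition frobenius (S : set nat) : nat := \max_(l <- gaps S) l.

(* The maximum is over a set that contains 0 when S is a numerical set other
   than [setT]. *)
Definition base (S : set nat) : nat :=
  \max_(s < frobenius S | (s : nat) \in S) s.

Definition row_length (S : set nat) (l : nat) : nat :=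
  #|[pred s : 'I_l | (s : nat) \in S]|.

(* A Young diagram is given by its row lengths from top to bottom. *)
Definition young_diagram (S : set nat) : seq nat :=
  [seq row_length S l | l <- gaps S].

Definition diagram_complement (la : seq nat) : seq nat :=
  [seq r <- rev [seq head 0 la - r | r <- la] | 0 < r].

(* The numerical set whose Young diagram is the complement of that of S, as a
   definite description: [setT] is only the default value of [xget], taken when
   no such numerical set exists. *)
Definition complement (S : set nat) : set nat :=
  xget setT [set T | numerical_set T /\
                     young_diagram T = diagram_complement (young_diagram S)].

(* Main.v *)
(** A gap of S is the number of elements of S below it plus the number of gaps
    below it, so the Young diagram of S determines its gaps. It then suffices
    to compute the diagram of the claimed set: its gaps are the B(S) - l for l
    a gap of S with l < B(S), and the row of B(S) - l counts the elements of S
    in (l, B(S)], i.e. has length lambda_1 - row_length S l. The gaps of S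
    above B(S) are those whose row has full length lambda_1. *)
Require Import Defs.
From mathcomp Require Import all_boot finmap.
From mathcomp Require Import boolp classical_sets cardinality.
From mathcomp Require Import zify.

Local Open Scope nat_scope.
Local Open Scope classical_set_scope.

Lemma gtn_trans : transitive gtn.
Proof. by move=> m n p /= mn /ltn_trans; apply. Qed.

Lemma row_length_sum (S : set nat) (n : nat) :
  row_length S n = \sum_(i < n) ((i : nat) \in S).
Proof. by rewrite /row_length -sum1_card big_mkcond. Qed.

Lemma row_length0 (S : set nat) : row_length S 0 = 0.
Proof. by rewrite row_length_sum big_ord0. Qed.

Lemma row_lengthS (S : set nat) (n : nat) :
  row_length S n.+1 = row_length S n + (n \in S).
Proof. by rewrite !row_length_sum big_ord_recr. Qed.

Lemma leq_row_length (S : set nat) : {homo row_length S : m n / m <= n}.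
Proof.
move=> m n /subnK <-; elim: (n - m) => // k IH.
by rewrite addSn row_lengthS; apply: leq_trans IH (leq_addr _ _).
Qed.

Lemma mem_gaps (S : set nat) (l : nat) :
  finite_set (~` S) -> (l \in gaps S) = (l \notin S).
Proof. by move=> fS; rewrite mem_sort in_fset_set // in_setC. Qed.

Lemma gaps_sorted (S : set nat) : sorted gtn (gaps S).
Proof.
rewrite gtn_sorted_uniq_geq sort_uniq fset_uniq /=.
by apply: sort_sorted => m n; exact: leq_total.
Qed.

(** Each number below [n] is counted once, either as an element or as a gap. *)
Lemma row_length_add_gaps (S : set nat) (n : nat) : finite_set (~` S) ->
  row_length S n + count (fun l => l < n) (gaps S) = n.
Proof.
move=> fS; elim: n => [|n IH].
  by rewrite row_length0 (eq_count (a2 := pred0)) ?count_pred0.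
have uS : uniq (gaps S) by rewrite sort_uniq fset_uniq.
have -> : count (fun l => l < n.+1) (gaps S)
  = count (fun l => l < n) (gaps S) + (n \notin S).
  rewrite -mem_gaps // -count_uniq_mem // -count_predUI.
  rewrite [X in _ + X](eq_count (a2 := pred0)) ?count_pred0 ?addn0.
    by apply: eq_count => l /=; rewrite ltnS leq_eqVlt orbC.
  by move=> l /=; case: eqP => [->|]; rewrite ?ltnn ?andbF.
rewrite row_lengthS; case: (n \in S) => /=; lia.
Qed.

(** In a strictly decreasing list the entries below the head are exactly the tail, so the head is
    its row length plus the size of the tail: the list is rebuilt from its last entry upwards. *)
Lemma sorted_gtn_inj_rows (r1 r2 : nat -> nat) (s1 s2 : seq nat) :
    sorted gtn s1 -> sorted gtn s2 ->
    {in s1, forall l, r1 l + count (fun k => k < l) s1 = l} ->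
    {in s2, forall l, r2 l + count (fun k => k < l) s2 = l} ->
  map r1 s1 = map r2 s2 -> s1 = s2.
Proof.
elim: s1 s2 => [|x s1 IH] [|y s2] //= so1 so2 h1 h2 [rxy rs].
have E z s : path gtn z s -> count (fun k => k < z) s = size s.
  by rewrite (path_sortedE gtn_trans) all_count => /andP[/eqP].
(* The head exceeds every later entry, so dropping it changes none of their counts. *)
have tl z s (r : nat -> nat) : path gtn z s ->
    {in z :: s, forall l, r l + count (fun k => k < l) (z :: s) = l} ->
    {in s, forall l, r l + count (fun k => k < l) s = l}.
  rewrite (path_sortedE gtn_trans) => /andP[/allP zs _] h l ls.
  have := h l; rewrite inE ls orbT /= => /(_ isT).
  by rewrite ltnNge (ltnW (zs l ls)) /=.
have es : s1 = s2.
  by apply: IH rs; [exact: path_sorted so1 | exact: path_sorted so2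
    | exact: tl so1 h1 | exact: tl so2 h2].
have := h1 x (mem_head _ _); have := h2 y (mem_head _ _) => /=.
by rewrite !ltnn !E // -es rxy => -> ->.
Qed.

Lemma young_diagram_inj (S T : set nat) :
  finite_set (~` S) -> finite_set (~` T) ->
  young_diagram S = young_diagram T -> S = T.
Proof.
move=> fS fT yST.
have gST : gaps S = gaps T.
  by apply: sorted_gtn_inj_rows yST; [exact: gaps_sorted | exact: gaps_sorted
    | move=> l _; exact: row_length_add_gaps
    | move=> l _; exact: row_length_add_gaps].
apply/seteqP; split=> l /mem_set lS; apply/set_mem/negPn;
  [rewrite -mem_gaps // -gST | rewrite -mem_gaps // gST]; by rewrite mem_gaps // lS.
Qed.

Lemma gaps_head (S : set nat) :
  gaps S != [::] -> gaps S = frobenius S :: behead (gaps S).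
Proof.
have := gaps_sorted S; rewrite /frobenius.
case: (gaps S) => // x s /=; rewrite (path_sortedE gtn_trans) => /andP[/allP xs _] _.
rewrite big_cons; congr (_ :: _); apply/esym/maxn_idPl/bigmax_leqP_seq => l ls _.
exact: ltnW (xs l ls).
Qed.

Definition reflection (S : set nat) : set nat :=
  [set base S - s | s in [set s | S s /\ s <= base S]] `|`
  [set n | base S <= n].

Section Complement.

Context {S : set nat} (hS : numerical_set S) (hSN : S <> setT).

Lemma gaps_neq_nil : gaps S != [::].
Proof.
apply/eqP => g0; apply/hSN/seteqP; split=> // l _.
by apply/set_mem/negPn; rewrite -mem_gaps ?g0 //; case: hS.
Qed.

Lemma frobenius_notin : frobenius S \notin S.
Proof.
have [_ fS] := hS.
by rewrite -mem_gaps // gaps_head ?mem_head // gaps_neq_nil.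
Qed.

Lemma base_in_lt : base S \in S /\ base S < frobenius S.
Proof.
have S0 : 0 \in S by apply/mem_set; case: hS.
have F0 : 0 < frobenius S.
  by rewrite lt0n; apply: contraNneq frobenius_notin => ->.
(* The witness 0 makes the range of the maximum nonempty, so the maximum is attained. *)
pose o := Ordinal F0.
have [|i iS] := @eq_bigmax_cond _ [pred s : 'I_(frobenius S) | (s : nat) \in S]
  (fun s => s : nat); first by apply/card_gt0P; exists o.
by rewrite /base => ->; split.
Qed.

Lemma leq_base (s : nat) : s \in S -> s < frobenius S -> s <= base S.
Proof.
move=> sS sF; exact: (@leq_bigmax_cond _
  (fun s : 'I_(frobenius S) => (s : nat) \in S) (fun s => s : nat) (Ordinal sF)).
Qed.

(** No element of [S] lies strictly between [base S] and [frobenius S], so the count is constant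
    there. *)
Lemma row_length_above_base (n : nat) :
  base S < n <= frobenius S -> row_length S n = row_length S (frobenius S).
Proof.
case/andP=> Bn nF; rewrite -(subnK nF).
have : frobenius S - n + n <= frobenius S by rewrite subnK.
elim: (_ - n) => // k IH kF; rewrite addSn row_lengthS -IH; last by lia.
case: (boolP (_ \in S)) => [/leq_base|_]; last by rewrite addn0.
lia.
Qed.

Lemma mem_reflection (n : nat) :
  (n \in reflection S) = (base S <= n) || (base S - n \in S).
Proof.
apply/idP/idP => [/set_mem [[s [Ss sB] <-]|/= ->] //|].
  by rewrite subKn // (mem_set Ss) orbT.
case: (leqP (base S) n) => [Bn _|nB /= sS]; apply/mem_set; first by right.
left; exists (base S - n); last by rewrite subKn // ltnW.
by split; [exact: set_mem | exact: leq_subr].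
Qed.

Lemma reflection_numerical : numerical_set (reflection S).
Proof.
have [BS _] := base_in_lt.
split; first by apply: set_mem; rewrite mem_reflection subn0 BS orbT.
apply: (sub_finite_set (B := `I_(base S))); last exact: finite_II.
by move=> n nT /=; rewrite ltnNge; apply/negP => Bn; apply: nT; right.
Qed.

(** The elements of [reflection S] below [n] mirror those of [S] in ([base S - n], [base S]]. The
    first summand counts the elements up to [base S - n] inclusive, whence the successor; together
    they exhaust the elements of [S] below [frobenius S]. *)
Lemma row_length_reflection (n : nat) : n <= base S ->
  row_length S (base S - n).+1 + row_length (reflection S) n = row_length S (frobenius S).
Proof.
have [BS BF] := base_in_lt.
elim: n => [|n IH] nB.
  by rewrite subn0 row_length0 addn0 row_length_above_base // leqnn.
rewrite -IH 1?ltnW // -subSn // subSS !row_lengthS mem_reflection.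
by rewrite leqNgt nB /=; lia.
Qed.

Lemma gaps_reflection :
  gaps (reflection S) = rev [seq base S - l | l <- gaps S & l < base S].
Proof.
have [BS _] := base_in_lt.
have [[S0 fS] [_ fT]] := (hS, reflection_numerical).
(* Both lists are strictly decreasing, the [rev] undoing the order reversal of the reflection, so
   equal membership suffices. *)
apply: (irr_sorted_eq gtn_trans); first by move=> n /=; rewrite ltnn.
- exact: gaps_sorted.
- rewrite rev_sorted sorted_map.
  apply: (@sub_in_sorted _ (fun l => l < base S) gtn).
  + by move=> m n mB nB /= nm; rewrite /relpre /=; lia.
  + exact: filter_all.
  + by apply: (sorted_filter gtn_trans); last exact: gaps_sorted.
move=> n; rewrite mem_rev mem_gaps // mem_reflection negb_or -ltnNge.
apply/andP/mapP => [[nB nS]|[l]].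
  exists (base S - n); last by lia.
  rewrite mem_filter mem_gaps // nS andbT.
  (* The case [n = 0] is excluded because [base S] is not a gap. *)
  by case: n nB nS => [|n] nB; rewrite ?subn0 ?BS //; lia.
rewrite mem_filter mem_gaps // => /andP[lB lS] ->.
rewrite (subKn (ltnW lB)); split=> //.
by case: l lB lS => [|l] lB; rewrite ?(mem_set S0) //; lia.
Qed.

(** The row of a gap below [base S] misses at least [base S] itself. This tells which rows of the
    complement are nonempty. *)
Lemma row_length_gap_ltn (l : nat) : l \in gaps S ->
  (row_length S l < row_length S (frobenius S)) = (l < base S).
Proof.
have [BS BF] := base_in_lt.
have [_ fS] := hS.
move=> lg; have lS : l \notin S by rewrite -mem_gaps.
have lF : l <= frobenius S.
  by rewrite /frobenius; exact: (leq_bigmax_seq (F := id)).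
case: (ltngtP l (base S)) => [lB|Bl|lB]; last by rewrite lB BS in lS.
- rewrite -(row_length_above_base (base S).+1) ?leqnn // row_lengthS BS addn1 ltnS.
  exact/leq_row_length/ltnW.
- by rewrite row_length_above_base ?Bl // ltnn.
Qed.

Lemma young_diagram_reflection :
  young_diagram (reflection S) = diagram_complement (young_diagram S).
Proof.
have [_ fS] := hS.
rewrite /diagram_complement; have -> : head 0 (young_diagram S) = row_length S (frobenius S).
  by rewrite /young_diagram gaps_head ?gaps_neq_nil.
rewrite /young_diagram gaps_reflection filter_rev map_rev.
congr rev; rewrite -!map_comp filter_map.
rewrite [in RHS](eq_in_filter (a2 := fun l => l < base S)); last first.
  by move=> l lg /=; rewrite subn_gt0 row_length_gap_ltn.
apply/eq_in_map => l; rewrite mem_filter mem_gaps // => /andP[lB lS] /=.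
(* As [l] is a gap, counting up to [l] inclusive or exclusive gives the same number. *)
rewrite -(row_length_reflection (base S - l)) ?leq_subr // (subKn (ltnW lB)).
by rewrite row_lengthS (negbTE lS) addn0 addKn.
Qed.

End Complement.

Theorem theorem2p2 (S : set nat) (hS : numerical_set S) (hSN : S <> setT) :
  complement S =
    [set base S - s | s in [set s | S s /\ s <= base S]] `|`
    [set n | base S <= n].
Proof.
have nR := reflection_numerical hS hSN.
(* Existence and uniqueness of the described set rule out the default value of [xget]. *)
apply: xget_unique => [|T [[_ fT] yT]].
  by split; [exact: nR | exact: young_diagram_reflection].
apply: (@young_diagram_inj _ (reflection S)) => //; first by case: nR.
by rewrite yT young_diagram_reflection.
Qed.
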